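(* Let $n\ge 3$, let $h$ be a Boolean function on $V_{n-1}$ with $\mathbf{L}_h^{even}\ge 1$, let $b\in V_1$, let $g(x_1,\dots,x_{n-1})=\bigoplus_{i=1}^{n-1}x_i\oplus b$, and let $l$ be either $l(x)=h(x)$ or $l(x)=h(x\oplus a)$ for some $a\in V_{n-1}$ of odd Hamming weight. Suppose $f=(h\,|\,l\oplus g)$ is balanced. Then \[ 2^{2n}\big(1+\mathbf{L}_h^{even}\big)\le \sigma_f\le 2^{3n-2}. \]
   Context: $V_m=\mathbb{Z}_2^m$. For Boolean functions $h,k$ on $V_{n-1}$, $(h\,|\,k)$ is the function $f$ on $V_n$ with $f(x',0)=h(x')$, $f(x',1)=k(x')$ for $x'\in V_{n-1}$. A Boolean function $f$ on $V_n$ is balanced if it takes the value $1$ exactly $2^{n-1}$ times. Write $\hat f(x)=(-1)^{f(x)}$, $\Delta_f(\alpha)=\sum_{x\in V_n}\hat f(x)\hat f(x\oplus\alpha)$, and the sum-of-squares indicator $\sigma_f=\sum_{\alpha\in V_n}\Delta_f(\alpha)^2$. A nonzero vector $\alpha$ is a linear structure of $h$ if $h(x)\oplus h(x\oplus\alpha)$ is constant in $x$; $\mathbf{L}_h^{even}$ denotes the number of nonzero linear structures of $h$ of even Hamming weight. *)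

(* Defs.v *)
From mathcomp Require Import all_boot all_order all_algebra.

Set Implicit Arguments.
Unset Strict Implicit.
Unset Printing Implicit Defensive.

Import GRing.Theory.
Local Open Scope ring_scope.

(* Addition in 'F_2, in [V m] and (pointwise) in [boolfun m] is the XOR. *)
Notation V m := ('rV['F_2]_m).
Notation boolfun m := {ffun V m -> 'F_2}.

Definition weight (m : nat) (x : V m) : nat := #|[set i | x 0 i == 1]|.

(* The vector (x', c) of V_n, for n >= 1: [insub i] is the index i < n.-1 seen
   in 'I_n.-1, and is None exactly when i is the last index of 'I_n. *)
Definition extend (n : nat) (x' : V n.-1) (c : 'F_2) : V n :=
  \row_(i < n) if insub (val i) is Some j then x' 0 j else c.

Definition is_concat (n : nat) (f : boolfun n) (h k : boolfun n.-1) : Prop :=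
  forall x' : V n.-1, f (extend x' 0) = h x' /\ f (extend x' 1) = k x'.

Definition balanced (n : nat) (f : boolfun n) : bool :=
  #|[set x | f x == 1]| == (2 ^ n.-1)%N.

(* The exponent is [f x] coerced from 'F_2 to nat, i.e. 0 or 1. *)
Definition sgnfun (n : nat) (f : boolfun n) (x : V n) : int := (-1) ^+ f x.

Definition autocorr (n : nat) (f : boolfun n) (a : V n) : int :=
  \sum_(x : V n) sgnfun f x * sgnfun f (x + a).

Definition sumsq (n : nat) (f : boolfun n) : int :=
  \sum_(a : V n) autocorr f a ^+ 2.

Definition linear_structure (m : nat) (h : boolfun m) (a : V m) : bool :=
  (a != 0) && [exists c : 'F_2, [forall x : V m, h x + h (x + a) == c]].

Definition Leven (m : nat) (h : boolfun m) : nat :=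
  #|[set a | linear_structure h a & ~~ odd (weight a)]|.

(* Main.v *)
(** Write f-hat for (-1)^f.  The autocorrelation of f vanishes off the hyperplane
    E of all (x', c) with wt(x') + c wt(a) even, where l(x) = h(x + a) (a = 0 if
    l = h).  On E split it as D0 + D1, according to whether the summation variable
    is in E.  The cross term sum_(E) D0 D1 is the sum over b outside E of
    (Delta_f(b) / 2)^2, hence zero, so sigma_f = sum_(E) (D0^2 + D1^2), and
    |D0|, |D1| <= |E| = 2^(n-1) gives the upper bound.  For the lower bound, 0 and
    the even linear structures of h give autocorrelation values +-2^n. *)
Require Import Defs.
From mathcomp Require Import all_boot all_order all_algebra.
From mathcomp Require Import ring zify.
Import Order.TTheory GRing.Theory Num.Theory.
Set Implicit Arguments.
Unset Strict Implicit.
Unset Printing Implicit Defensive.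
Local Open Scope ring_scope.

(** * Arithmetic and signs over ['F_2] *)

Lemma addF2_self (z : 'F_2) : z + z = 0.
Proof. by case: z => [[|[|//]] ?]; apply: val_inj. Qed.

Lemma addV_self m (x : V m) : x + x = 0.
Proof. by apply/matrixP=> i j; rewrite !mxE addF2_self. Qed.

Lemma addVK m (x y : V m) : x + y + y = x.
Proof. by rewrite -addrA addV_self addr0. Qed.

Lemma F2_cases (z : 'F_2) : z = 0 \/ z = 1.
Proof. by case: z => [[|[|//]] ?]; [left|right]; apply: val_inj. Qed.

(** The exponent on the left is reduced modulo 2, which is harmless because (-1)^2 = 1. *)
Lemma signF2D (y z : 'F_2) : (-1 : int) ^+ (y + z)%R = (-1) ^+ y * (-1) ^+ z.
Proof. by case: (F2_cases y) => ->; case: (F2_cases z) => ->. Qed.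

Lemma sgnfun_norm m (f : boolfun m) x : `|sgnfun f x| = 1.
Proof. exact: normr_sign. Qed.

Lemma card_V m : #|{: V m}| = (2 ^ m)%N.
Proof. by rewrite card_mx card_Fp // mul1n. Qed.

(** * Autocorrelation vanishing off a hyperplane *)

Section Hyperplane.

(** [phi] is a linear functional to ['F_2] written as a Boolean predicate; the hyperplane E is its
    kernel, where [phi] is false. *)
Variables (m : nat) (phi : pred (V m)).
Hypothesis phiD : {morph phi : x y / x + y >-> x (+) y}.

Lemma hyperplane_dim_gt0 v : phi v -> (0 < m)%N.
Proof.
move=> phi_v; rewrite lt0n; apply: contraL phi_v => /eqP m0.
have -> : v = 0 by apply/matrixP=> i j; have := ltn_ord j; rewrite [X in (_ < X)%N]m0.
by rewrite -(addV_self v) phiD addbb.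
Qed.

(** Translation by [v] exchanges E and its complement, so each is half of the space. *)
Lemma card_hyperplane v : phi v ->
  (#|[pred x | ~~ phi x]| = 2 ^ m.-1)%N /\ (#|phi| = 2 ^ m.-1)%N.
Proof.
move=> phi_v.
have eq_card2 : #|[pred x | ~~ phi x]| = #|phi|.
  rewrite -!sum1_card (reindex_inj (addIr v)) /=.
  by apply: eq_bigl => x; rewrite !inE phiD phi_v addbT negbK.
have two_exp : (2 ^ m = 2 * 2 ^ m.-1)%N by rewrite -expnS prednK // (hyperplane_dim_gt0 phi_v).
have := cardC phi; rewrite card_V two_exp.
have -> : #|[predC phi]| = #|[pred x | ~~ phi x]| by apply: eq_card.
rewrite /= eq_card2; lia.
Qed.

Variable f : boolfun m.
Local Notation F := (sgnfun f).
Let D0 a := \sum_(x | ~~ phi x) F x * F (x + a).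
Let D1 a := \sum_(x | phi x) F x * F (x + a).

Let autocorrE a : autocorr f a = D0 a + D1 a.
Proof. by rewrite /autocorr (bigID phi) addrC. Qed.

(** Translation by [b] exchanges E and its complement, and it merely swaps the two factors of each
    term. *)
Let D0_eq_D1 b : phi b -> D0 b = D1 b.
Proof.
move=> phi_b; rewrite /D0 (reindex_inj (addIr b)) /=.
apply: eq_big => [x|x _]; first by rewrite phiD phi_b addbT negbK.
by rewrite addVK mulrC.
Qed.

(** Both sides sum [F] over the corners x, x + a, x + b, x + a + b of parallelograms with x and a in
    E and b outside E; they differ only in how the corners are paired. *)
Let cross_term : \sum_(a | ~~ phi a) D0 a * D1 a = \sum_(b | phi b) D0 b ^+ 2.
Proof.
transitivity (\sum_(x | ~~ phi x) \sum_(a | ~~ phi a) \sum_(b | phi b)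
   F x * F (x + a) * (F (x + b) * F (x + b + a))).
  rewrite exchange_big /=; apply: eq_bigr => a _.
  rewrite big_distrl; apply: eq_bigr => x Ex.
  (* The variable of [D1] is written x + b; as x lies in E, it is outside E exactly when b is. *)
  rewrite big_distrr (reindex_inj (addrI x)) /=.
  by apply: eq_bigl => b; rewrite phiD (negbTE Ex).
rewrite exchange_big /=.
under eq_bigr do rewrite exchange_big /=.
rewrite exchange_big /=; under eq_bigr do rewrite exchange_big /=.
apply: eq_bigr => b _.
rewrite expr2 {1}/D0 big_distrl; apply: eq_bigr => x Ex.
rewrite /D0 big_distrr [RHS](reindex_inj (addrI x)) /=.
apply: eq_big => [a|a _]; first by rewrite phiD (negbTE Ex).
rewrite (addrAC x b a); ring.
Qed.

Lemma sumsq_le_hyperplane v :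
  phi v -> (forall b, phi b -> autocorr f b = 0) -> sumsq f <= 2 ^+ (3 * m - 2).
Proof.
move=> phi_v f0; have [cardE cardC] := card_hyperplane phi_v.
have m_gt0 := hyperplane_dim_gt0 phi_v.
have [v_ge0 two_v] : (0 <= 2 ^+ m.-1 :> int) /\ (2 ^+ m.-1 : int) = (2 ^ m.-1)%:R.
  by rewrite natrX exprn_ge0.
have D_le (P : pred (V m)) a : #|P| = (2 ^ m.-1)%N ->
    (\sum_(x | P x) F x * F (x + a)) ^+ 2 <= (2 ^+ m.-1) ^+ 2.
  move=> cardP; rewrite -real_normK ?num_real // lerXn2r ?nnegrE //.
  apply: le_trans (ler_norm_sum _ _ _) _.
  under eq_bigr do rewrite normrM !sgnfun_norm mulr1.
  by rewrite sumr_const cardP two_v.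
have -> : sumsq f = \sum_(a | ~~ phi a) (D0 a ^+ 2 + D1 a ^+ 2).
  rewrite /sumsq (bigID phi) /= big1 ?add0r; last by move=> a /f0 ->.
  transitivity (\sum_(a | ~~ phi a) (D0 a ^+ 2 + D1 a ^+ 2)
     + 2 * \sum_(a | ~~ phi a) D0 a * D1 a).
    rewrite big_distrr -big_split; apply: eq_bigr => a _.
    by rewrite autocorrE /=; ring.
  (* Outside E the two halves agree, so [f0] says 2 * [D0 b] = 0. *)
  rewrite cross_term [X in 2 * X]big1 ?mulr0 ?addr0 // => b phi_b.
  have := f0 b phi_b; rewrite autocorrE -D0_eq_D1 // => /eqP.
  by rewrite -mulr2n mulrn_eq0 /= => /eqP ->; rewrite expr0n.
apply: (@le_trans _ _ (\sum_(a | ~~ phi a) 2 * (2 ^+ m.-1) ^+ 2)).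
  apply: ler_sum => a _; rewrite mulr_natl mulr2n lerD //; exact: D_le.
rewrite sumr_const cardE -[_ *+ (2 ^ _)]mulr_natl -two_v mulrCA -exprM -exprD -exprS.
by rewrite [X in _ <= 2 ^+ X](_ : _ = (m.-1 + m.-1 * 2).+1) //; lia.
Qed.

End Hyperplane.

(** * Parity of the weight as a linear functional *)

Definition coord_sum (m : nat) (x : V m) : 'F_2 := \sum_(i < m) x 0 i.

Lemma coord_sumD m : {morph @coord_sum m : x y / x + y}.
Proof.
by move=> x y; rewrite -big_split; apply: eq_bigr => i _; rewrite mxE.
Qed.

Lemma coord_sum_weight m (x : V m) : coord_sum x = (odd (weight x))%:R.
Proof.
have nat_F2 k : k%:R = (odd k)%:R :> 'F_2.
  elim: k => // k IHk; rewrite -(addn1 k) natrD IHk oddD.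
  by case: (odd k); rewrite ?add0r //= addF2_self.
rewrite -nat_F2 /weight -sum1_card natr_sum big_mkcond.
apply: eq_bigr => i _; rewrite inE.
by case: (F2_cases (x 0 i)) => ->.
Qed.

(** * Autocorrelation of a concatenation *)

Section Concatenation.

Variable N : nat.
Local Notation extend := (@extend N.+1).

Let restrict (y : V N.+1) : V N := \row_i y 0 (lift ord_max i).

Lemma extend_max (x : V N) c : extend x c 0 ord_max = c.
Proof. by rewrite mxE insubF //= ltnn. Qed.

Lemma extend_lift (x : V N) c i : extend x c 0 (lift ord_max i) = x 0 i.
Proof.
rewrite mxE [val _]lift_max; case: insubP => [j _ j_i|]; last by rewrite ltn_ord.
by congr (x 0 _); apply: val_inj.
Qed.

Lemma restrictK y : extend (restrict y) (y 0 ord_max) = y.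
Proof.
apply/rowP => i; case: (unliftP ord_max i) => [j|] ->.
  by rewrite extend_lift mxE.
by rewrite extend_max.
Qed.

Lemma extendK (x : V N) c : restrict (extend x c) = x.
Proof. by apply/rowP => i; rewrite mxE extend_lift. Qed.

Lemma extendD (x y : V N) c d : extend x c + extend y d = extend (x + y) (c + d).
Proof.
apply/rowP => i; rewrite mxE; case: (unliftP ord_max i) => [j|] ->.
  by rewrite !extend_lift mxE.
by rewrite !extend_max.
Qed.

Lemma sum_extend (G : V N.+1 -> int) :
  \sum_y G y = \sum_(x : V N) (G (extend x 0) + G (extend x 1)).
Proof.
rewrite (reindex (fun p : V N * 'F_2 => extend p.1 p.2)) /=; last first.
  exists (fun y => (restrict y, y 0 ord_max)) => [[x c] _|y _] /=.
    by rewrite extendK extend_max.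
  exact: restrictK.
rewrite -(pair_bigA _ (fun x c => G (extend x c))) /=.
apply: eq_bigr => x _; rewrite big_ord_recl big_ord1.
by congr (G (extend _ _) + G (extend _ _)); apply: val_inj.
Qed.

Variables (a : V N) (b : 'F_2) (h l g : boolfun N) (f : boolfun N.+1).
Hypothesis gE : forall x, g x = coord_sum x + b.
Hypothesis lE : forall x, l x = h (x + a).
Hypothesis fE : @is_concat N.+1 f h (l + g).

Let sgn_f0 x : sgnfun f (extend x 0) = sgnfun h x.
Proof. by rewrite /sgnfun (fE x).1. Qed.

Let sgn_f1 x : sgnfun f (extend x 1) = sgnfun h (x + a) * sgnfun g x.
Proof. by rewrite /sgnfun (fE x).2 ffunE signF2D lE. Qed.

Let sgn_gD x y : sgnfun g (x + y) = sgnfun g x * (-1) ^+ coord_sum y.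
Proof. by rewrite /sgnfun -signF2D !gE coord_sumD addrAC. Qed.

(** On the half with last coordinate 1, [g] contributes the constant sign (-1)^([coord_sum v]), and
    translation by [a] turns what remains into [autocorr h v]. *)
Lemma autocorr_extend0 v :
  autocorr f (extend v 0) = (1 + (-1) ^+ coord_sum v) * autocorr h v.
Proof.
rewrite /autocorr sum_extend big_split mulrDl mul1r; congr (_ + _).
  by apply: eq_bigr => x _; rewrite extendD addr0 !sgn_f0.
rewrite [in RHS](reindex_inj (addIr a)) big_distrr; apply: eq_bigr => x _ /=.
rewrite extendD addr0 !sgn_f1 sgn_gD (addrAC x a v).
have s1 : sgnfun g x * sgnfun g x = 1 by rewrite -expr2 sqrr_sign.
by rewrite mulrACA [X in _ * X]mulrA s1 mul1r mulrC.
Qed.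

(** The terms at (x, 0) and (x + a, 1) cancel: their [h] factors agree, while their [g] factors, at
    x + v and x + a, have opposite signs. *)
Lemma autocorr_extend1 v :
  coord_sum v + coord_sum a = 1 -> autocorr f (extend v 1) = 0.
Proof.
move=> va1; rewrite /autocorr sum_extend big_split /=.
rewrite [X in _ + X](reindex_inj (addIr a)) -big_split big1 //= => x _.
rewrite !extendD add0r addF2_self !sgn_f0 !sgn_f1 addVK.
have -> : sgnfun g (x + a) = - sgnfun g (x + v).
  have -> : x + a = x + v + (v + a) by rewrite addrA addVK.
  by rewrite sgn_gD coord_sumD va1 expr1 mulrN1.
rewrite (addrAC x a v); ring.
Qed.

Lemma sumsq_concat_le : (0 < N)%N -> sumsq f <= 2 ^+ (3 * N.+1 - 2).
Proof.
move=> N_gt0.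
(* The functional whose kernel is E; a unit vector with last coordinate 0 shows that it is
   nonzero. *)
pose psi y := coord_sum (restrict y) + coord_sum a * y 0 ord_max.
have psiE x c : psi (extend x c) = coord_sum x + coord_sum a * c.
  by rewrite /psi extendK extend_max.
have psiD x y : psi (x + y) = psi x + psi y.
  rewrite -[x]restrictK -[y]restrictK extendD !psiE coord_sumD; ring.
apply: (@sumsq_le_hyperplane _ (fun y => psi y == 1) _ f
          (extend (delta_mx 0 (Ordinal N_gt0)) 0)).
- move=> x y; rewrite psiD.
  by case: (F2_cases (psi x)) => ->; case: (F2_cases (psi y)) => ->.
- rewrite psiE mulr0 addr0 /coord_sum (bigD1 (Ordinal N_gt0)) //= mxE !eqxx.
  by rewrite big1 // => i /negbTE i_neq; rewrite mxE i_neq.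
- move=> y; rewrite -[y]restrictK psiE.
  case: (F2_cases (y 0 ord_max)) => -> /eqP.
    by rewrite mulr0 addr0 autocorr_extend0 => ->; rewrite mul0r.
  by rewrite mulr1; apply: autocorr_extend1.
Qed.

Lemma le_sumsq_concat :
  2 ^+ (2 * N.+1) * (1 + (Leven h)%:Z) <= sumsq f.
Proof.
(* The zero vector supplies the summand 1 of the bound. *)
pose S := 0 |: [set v | linear_structure h v & ~~ odd (weight v)].
have cardS : #|S| = (1 + Leven h)%N by rewrite cardsU1 inE /linear_structure eqxx.
rewrite /sumsq sum_extend.
(* Squares are nonnegative, so all terms at (v, 1), and those at (v, 0) with v outside [S], are
   dropped. *)
apply: (@le_trans _ _ (\sum_(v in S) autocorr f (extend v 0) ^+ 2)); last first.
  rewrite [X in X <= _]big_mkcond; apply: ler_sum => v _.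
  by case: ifP => _; rewrite ?lerDl ?addr_ge0 ?sqr_ge0.
rewrite [leRHS](_ : _ = \sum_(v in S) 2 ^+ (2 * N.+1)); last first.
  apply: eq_bigr => v; rewrite !inE => Sv.
  have -> : autocorr f (extend v 0) = 2 * autocorr h v.
    rewrite autocorr_extend0 coord_sum_weight.
    suff /negbTE -> : ~~ odd (weight v) by rewrite expr0.
    case/orP: Sv => [/eqP ->|/andP[]//].
    by rewrite /weight eq_card0 // => i; rewrite !inE mxE.
  have [c hc] : exists c, forall x, h x + h (x + v) = c.
    case/orP: Sv => [/eqP ->|/andP[/andP[_ /existsP[c /forallP hc]] _]].
      by exists 0 => x; rewrite addr0 addF2_self.
    by exists c => x; apply/eqP.
  (* All 2^N terms equal the sign (-1)^c, which disappears on squaring. *)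
  have -> : autocorr h v = 2 ^+ N * (-1) ^+ c.
    rewrite /autocorr; under eq_bigr do rewrite -signF2D hc.
    by rewrite sumr_const card_V -[LHS]mulr_natl natrX.
  by rewrite mulrA -exprS exprMn sqrr_sign mulr1 -exprM mulnC.
by rewrite sumr_const cardS -[leRHS]mulr_natr natrD (natz (Leven h)).
Qed.

End Concatenation.

Theorem theorem1 (n : nat) (n_ge3 : (3 <= n)%N)
    (h : boolfun n.-1) (h_even : (1 <= Leven h)%N)
    (b : 'F_2)
    (g : boolfun n.-1) (gE : forall x : V n.-1, g x = \sum_(i < n.-1) x 0 i + b)
    (l : boolfun n.-1)
    (lE : (forall x : V n.-1, l x = h x) \/
          (exists2 a : V n.-1, odd (weight a) &
                   forall x : V n.-1, l x = h (x + a)))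
    (f : boolfun n) (fE : is_concat f h (l + g)) (f_bal : balanced f) :
  2 ^+ (2 * n) * (1 + (Leven h)%:Z) <= sumsq f <= 2 ^+ (3 * n - 2).
Proof.
case: n n_ge3 h h_even g gE l lE f fE f_bal => // N N_ge2 h _ g gE l lE f fE _.
(* The case l = h is the translation by a = 0. *)
have [a la] : exists a, forall x, l x = h (x + a).
  by case: lE => [lh|[a _ la]]; [exists 0 => x; rewrite addr0 | exists a].
apply/andP; split; first exact: le_sumsq_concat gE la fE.
by apply: (sumsq_concat_le gE la fE); apply: ltnW.
Qed.
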